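(* Let $R$ be a finite unital ring (not necessarily commutative) with $0\neq 1$. The following conditions are equivalent: (1) $R$ has no quotient of the form $\mathbb{F}_2$. (2) $R$ has the $2$-sum property. (3) $R$ has at least one exceptional unit. (4) The unitary Cayley graph $G_R$ is not bipartite.
   Context: Ring homomorphisms preserve $1$. $R'$ is a quotient of $R$ if there is a surjective ring homomorphism $R\to R'$. $\mathbb{F}_2$ is the field with two elements. A ring $R$ has the $n$-sum property if every element of $R$ can be written as the sum of exactly $n$ elements of the unit group $R^\times$. A unit $u\in R^\times$ is called exceptional if $1-u$ is also a unit. The unitary Cayley graph $G_R$ is the graph with vertex set $R$ in which two vertices $a,b$ are adjacent if and only if $a-b\in R^\times$. *)

(* Defs.v *)
From HB Require Import structures.
From mathcomp Require Import all_boot all_order all_algebra.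

Set Implicit Arguments.
Unset Strict Implicit.
Unset Printing Implicit Defensive.

Import GRing.Theory.
Local Open Scope ring_scope.

(* Morphisms [{rmorphism _ -> _}] preserve 1. *)
Definition is_quotient (R S : nzRingType) : Prop :=
  exists f : {rmorphism R -> S}, forall y : S, exists x : R, f x = y.

(* Exactly [n] summands, repetitions allowed. *)
Definition n_sum_property (n : nat) (R : unitRingType) : Prop :=
  forall x : R, exists u : 'I_n -> R,
    (forall i, u i \is a GRing.unit) /\ x = \sum_(i < n) u i.

Definition exceptional_unit (R : unitRingType) (u : R) : bool :=
  (u \is a GRing.unit) && (1 - u \is a GRing.unit).

(* A simple graph on a finite type is given by its adjacency relation,
   symmetric and irreflexive. *)
Definition unitary_cayley_graph (R : finUnitRingType) : rel R :=
  fun a b => a - b \is a GRing.unit.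

Lemma unitary_cayley_graph_sym (R : finUnitRingType) :
  symmetric (@unitary_cayley_graph R).
Proof. by move=> a b; rewrite /unitary_cayley_graph -opprB unitrN. Qed.

Lemma unitary_cayley_graph_irr (R : finUnitRingType) :
  irreflexive (@unitary_cayley_graph R).
Proof. by move=> a; rewrite /unitary_cayley_graph subrr unitr0. Qed.

Definition bipartite (T : finType) (e : rel T) : Prop :=
  exists A B : {set T},
    [/\ A :|: B = [set: T], [disjoint A & B]
      & forall x y, e x y ->
          (x \in A) && (y \in B) || (x \in B) && (y \in A)].

(* Main.v *)
Require Import Defs.
From HB Require Import structures.
From mathcomp Require Import all_boot all_order all_algebra.

Set Implicit Arguments.
Unset Strict Implicit.
Unset Printing Implicit Defensive.

Import GRing.Theory.
Local Open Scope ring_scope.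

(** The implication from (1) to (2) carries the content; the other three are
    short.  If 1 = u + v with u, v units, then u is exceptional.  If u is
    exceptional, then 0, 1, u form a triangle in the unitary Cayley graph.  And
    a morphism to F_2 sends units to 1, so its two fibres are a bipartition.

    For (1) -> (2), write 1 as a sum of pairwise orthogonal primitive
    idempotents ([primitive_decomposition_exists]) and view each x as a matrix
    with entries e x f in e R f.  By Fitting's argument every corner ring e R e
    is local ([primitive_corner_local]).  If every diagonal entry e x e is a sum
    of two units of e R e, then so is x in R: put one family of units on the
    diagonal together with the entries of x above it, and the other family with
    the entries below it ([corner_two_sum_glue]).  In a local ring a nonunit y
    is 1 + (y - 1), and a unit is a sum of two units as soon as the ring has an
    exceptional unit.  So the only obstructions are indices i such that i R i
    has no exceptional unit and i x i is invertible.

    An obstruction is removed by replacing x by w x v with w, v units of R,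
    which does not affect being a sum of two units.  If some other idempotent j
    of the decomposition is isomorphic to i, then Gaussian elimination with the
    pivot i x i clears the entries (i, j) and (j, i), and exchanging rows i and
    j then leaves zeros at (i, i) and (j, j) ([clear_two_corners]); no other
    diagonal entry changes, so the number of obstructions decreases.  If there
    is no such j, then no product of an element of i R j with one of j R i is a
    unit of i R i.  Hence x |-> i x i is multiplicative modulo the nonunits of
    i R i.  As i R i has no exceptional unit its residue field is F_2, so that
    R has F_2 as a quotient ([residue_F2_quotient]). *)

(** * Finite rings *)

Section FiniteRing.
Variable R : finUnitRingType.
Implicit Types (x y z u v w a b c e f g i j k : R) (E : {set R}).

(** Left multiplication by y is injective because x is a left inverse of y,
    hence surjective, and y has a right inverse as well. *)
Lemma fin_mulr1_comm x y : x * y = 1 -> y * x = 1.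
Proof.
move=> xy1; have inj_y : injective ( *%R y).
  by move=> a b /(congr1 ( *%R x)); rewrite !mulrA xy1 !mul1r.
have [h _ hK] := injF_bij inj_y.
by have := hK 1 => /= yh; rewrite -[x]mulr1 -yh [x * _]mulrA xy1 mul1r.
Qed.

Lemma fin_unitr x y : x * y = 1 -> x \is a GRing.unit.
Proof. by move=> xy; apply/unitrP; exists y; rewrite fin_mulr1_comm. Qed.

Lemma fin_unitrM x y :
  (x * y \is a GRing.unit) = (x \is a GRing.unit) && (y \is a GRing.unit).
Proof.
apply/idP/andP => [Uxy|[Ux Uy]]; last by rewrite unitrMl.
have Ux : x \is a GRing.unit.
  by apply: (@fin_unitr _ (y * (x * y)^-1)); rewrite mulrA divrr.
by split=> //; rewrite -(unitrMr y Ux).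
Qed.

Lemma unitr_1B_sqr0 c : c * c = 0 -> 1 - c \is a GRing.unit.
Proof.
move=> cc; apply: (@fin_unitr _ (1 + c)).
by rewrite mulrDr mulr1 mulrBl mul1r cc subr0 subrK.
Qed.

(** The powers of x are eventually periodic; an exponent that is a multiple of
    the period d and lies beyond the preperiod p gives an idempotent. *)
Lemma fin_idempotent_power x : exists2 n, (0 < n)%N & x ^+ n * x ^+ n = x ^+ n.
Proof.
have /injectivePn[p [q neq_pq eq_pq]] :
    ~~ injectiveb (fun p : 'I_(#|R|.+1) => x ^+ p).
  apply/negP => /injectiveP inj; have := leq_card _ inj.
  by rewrite card_ord ltnn.
wlog lt_pq : p q neq_pq eq_pq / (p < q)%N.
  move=> th; case: (ltngtP p q) => [|lt_qp|/val_inj eq]; first exact: th.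
  - by apply: (th q p) => //; rewrite eq_sym.
  - by rewrite eq eqxx in neq_pq.
pose d := (q - p)%N; have d_gt0 : (0 < d)%N by rewrite subn_gt0.
have step t : (p <= t)%N -> x ^+ (t + d) = x ^+ t.
  move=> le_pt; rewrite -(subnK le_pt) -addnA subnKC; last exact: ltnW.
  by rewrite !exprD eq_pq.
have per t (c : nat) : (p <= t)%N -> x ^+ (t + c * d) = x ^+ t.
  move=> le_pt; elim: c => [|c IHc]; first by rewrite mul0n addn0.
  by rewrite mulSnr addnA step // (leq_trans le_pt) ?leq_addr.
(* p.+1 rather than p, so that the exponent is positive when p = 0 *)
exists (p.+1 * d)%N; first by rewrite muln_gt0.
rewrite -exprD per //; apply: leq_trans (leqnSn p) _.
exact: leq_pmulr.
Qed.

(** * Units of corner rings *)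

(** For an idempotent e this says that e x e is a unit of the ring e R e, whose
    identity is e.  Completing e x e by 1 - e turns this into invertibility in R
    itself, so that no ring structure on e R e has to be built. *)
Definition corner_unit e x : bool := e * x * e + (1 - e) \is a GRing.unit.

Section Corner.
Variable e : R.
Hypothesis ee : e * e = e.

Let mul_ee x : x * e * e = x * e. Proof. by rewrite -mulrA ee. Qed.
Let e1e : e * (1 - e) = 0. Proof. by rewrite mulrBr mulr1 ee subrr. Qed.
Let e1e' : (1 - e) * e = 0. Proof. by rewrite mulrBl mul1r ee subrr. Qed.
Let idem1e : (1 - e) * (1 - e) = 1 - e.
Proof. by rewrite mulrBr mulr1 e1e' subr0. Qed.

Lemma corner_block_mul a b :
  (e * a * e + (1 - e)) * (e * b * e + (1 - e)) =
  e * (a * e * b) * e + (1 - e).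
Proof.
move: (1 - e) e1e e1e' idem1e => d ed de dd.
rewrite mulrDl !mulrDr dd -[e * a * e * d]mulrA ed mulr0 addr0.
by rewrite !mulrA de !mul0r add0r mul_ee.
Qed.

Lemma corner_unit1 : corner_unit e 1.
Proof. by rewrite /corner_unit mulr1 ee addrC subrK unitr1. Qed.

Lemma corner_unitM x y :
  corner_unit e (x * e * y) = corner_unit e x && corner_unit e y.
Proof. by rewrite /corner_unit -corner_block_mul fin_unitrM. Qed.

Lemma corner_unit_eq x y :
  e * x * e = e * y * e -> corner_unit e x = corner_unit e y.
Proof. by rewrite /corner_unit => ->. Qed.

Lemma corner_unitN x : corner_unit e (- x) = corner_unit e x.
Proof.
have UN1 : corner_unit e (-1).
  suff: corner_unit e (-1 * e * -1) by rewrite corner_unitM => /andP[].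
  rewrite -(@corner_unit_eq 1) ?corner_unit1 //.
  by rewrite mulN1r mulrN1 opprK mulr1 ee ee.
transitivity (corner_unit e (-1 * e * x)); last by rewrite corner_unitM UN1.
apply: corner_unit_eq.
by rewrite mulN1r mulNr !mulrN !mulNr !mulrA ee.
Qed.

Lemma corner_unit0 : e != 0 -> ~~ corner_unit e 0.
Proof.
move=> e0; apply: contra e0; rewrite /corner_unit mulr0 mul0r add0r => U.
by rewrite -(mulrI_eq0 e (mulrI U)) e1e'.
Qed.

Lemma corner_unit_inv x : corner_unit e x ->
  exists z, [/\ e * z = z, z * e = z, z * x * e = e & e * x * z = e].
Proof.
rewrite /corner_unit; set T := _ + _ => UT.
have eT : e * T = e * x * e by rewrite mulrDr e1e addr0 !mulrA ee.
have Te : T * e = e * x * e by rewrite mulrDl e1e' addr0 mul_ee.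
have eTi : e * T^-1 = T^-1 * e.
  by apply: (mulrI UT); rewrite !mulrA Te -eT mulrK // divrr // mul1r.
exists (e * T^-1); split.
- by rewrite mulrA ee.
- by rewrite eTi mul_ee.
- by rewrite eTi -!mulrA [e * (x * e)]mulrA -Te mulKr.
- by rewrite mulrA -eT mulrK.
Qed.

End Corner.

(** * Corners at primitive idempotents *)

Definition primitive_idempotent e : Prop :=
  [/\ e != 0, e * e = e & forall g, g * g = g -> e * g = g -> g * e = g ->
    g = 0 \/ g = e].

(** Fitting's argument: with y = e x e, some power of y is an idempotent of
    e R e, hence 0 or e.  In the first case y is nilpotent, so that e - y is
    invertible; in the second y is invertible. *)
Lemma primitive_corner_local e x : primitive_idempotent e ->
  corner_unit e x || corner_unit e (1 - x).
Proof.
move=> [e0 ee prim]; pose y := e * x * e.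
have ey : e * y = y by rewrite /y !mulrA ee.
have ye : y * e = y by rewrite /y -mulrA ee.
have [[//|n] _ idem] := fin_idempotent_power y.
have [||y0|ye1] := prim _ idem; first by rewrite exprS mulrA ey.
- by rewrite exprSr -mulrA ye.
- apply/orP; right; rewrite /corner_unit mulrBr mulrBl mulr1 ee -/y.
  rewrite addrC addrA subrK; apply: (@fin_unitr _ (\sum_(i < n.+1) y ^+ i)).
  by apply: oppr_inj; rewrite -mulNr opprB -subrX1 y0 sub0r.
- apply/orP; left; rewrite /corner_unit -/y.
  apply: (@fin_unitr _ (e * y ^+ n * e + (1 - e))).
  by rewrite corner_block_mul // !mulrA -/y -exprS ye1 ee addrC subrK.
Qed.

(** The standard fact on local rings: if the sum had an inverse z in the corner,
    then z x and z y would add up to e, and one of them would be a unit. *)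
Lemma primitive_corner_nonunitD e x y : primitive_idempotent e ->
  ~~ corner_unit e x -> ~~ corner_unit e y -> ~~ corner_unit e (x + y).
Proof.
move=> prim nUx nUy; have [e0 ee _] := prim; apply/negP => Uxy.
have [z [ez ze zxye _]] := corner_unit_inv ee Uxy.
have := primitive_corner_local (z * e * x) prim; rewrite corner_unitM //.
rewrite (negPf nUx) andbF /= (@corner_unit_eq _ _ (z * e * y)) //.
  by rewrite corner_unitM // (negPf nUy) andbF.
rewrite ze mulrBr mulrBl mulr1 ee !mulrA ez -{1}zxye.
by rewrite mulrDr mulrDl addrC addKr.
Qed.

Definition corner_exceptional e : bool :=
  [exists a, corner_unit e a && corner_unit e (1 - a)].

(** A local ring without exceptional units has residue field F_2: exactly one
    of y and 1 - y is a unit.  So being a unit is reduction modulo the maximal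
    ideal, and the sum in F_2 is the exclusive or. *)
Section ResidueFieldF2.
Variable e : R.
Hypotheses (prim : primitive_idempotent e) (bad : ~~ corner_exceptional e).

Let ee : e * e = e. Proof. by case: prim. Qed.

Lemma corner_unit_1B x : corner_unit e (1 - x) = ~~ corner_unit e x.
Proof.
have := primitive_corner_local x prim.
have : ~~ (corner_unit e x && corner_unit e (1 - x)).
  by apply: contra bad => h; apply/existsP; exists x.
by do 2!case: corner_unit.
Qed.

Lemma corner_unitD x y :
  corner_unit e (x + y) = corner_unit e x (+) corner_unit e y.
Proof.
have nD a b : ~~ corner_unit e a -> ~~ corner_unit e b ->
  ~~ corner_unit e (a + b) by exact: primitive_corner_nonunitD.
have [Ux|nUx] := boolP (corner_unit e x);
  have [Uy|nUy] := boolP (corner_unit e y).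
- apply/negbTE; have -> : x + y = (x - 1) + (1 + y) by rewrite addrA subrK.
  apply: nD; first by rewrite -opprB corner_unitN // corner_unit_1B Ux.
  by rewrite -[y]opprK corner_unit_1B corner_unitN // Uy.
- apply/negPn/negP => nU.
  suff: ~~ corner_unit e x by rewrite Ux.
  by rewrite -(addrK y x); apply: nD => //; rewrite corner_unitN.
- apply/negPn/negP => nU.
  suff: ~~ corner_unit e y by rewrite Uy.
  by rewrite -(addKr x y); apply: nD => //; rewrite corner_unitN.
- exact/negbTE/nD.
Qed.

End ResidueFieldF2.

(** * Decomposition of 1 into primitive idempotents *)

(** Boolean, so that such a set of maximal cardinality can be selected. *)
Definition complete_orthogonal E : bool :=
  [&& [forall e in E, (e != 0) && (e * e == e)],
      [forall e in E, forall f in E, (e != f) ==> (e * f == 0)] &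
      \sum_(e in E) e == 1].

Definition primitive_decomposition E : Prop :=
  [/\ {in E, forall e, primitive_idempotent e},
      {in E &, forall e f, e != f -> e * f = 0} & \sum_(e in E) e = 1].

(** Take a family of nonzero orthogonal idempotents of sum 1 with as many
    members as possible: a member e that is not primitive could be replaced by
    g and e - g, which yields a larger family. *)
Lemma primitive_decomposition_exists : exists E, primitive_decomposition E.
Proof.
have co1 : complete_orthogonal [set 1].
  apply/and3P; split; last by rewrite big_set1.
  - by apply/forall_inP => e /set1P->; rewrite oner_neq0 mulr1 eqxx.
  - apply/forall_inP => e /set1P->; apply/forall_inP => f /set1P->.
    by rewrite eqxx.
case: (arg_maxnP (fun E : {set R} => #|E|) co1) => E.
move=> /and3P[idE orthE sumE] maxE.
have orth : {in E &, forall e f, e != f -> e * f = 0}.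
  move=> e f Ee Ef nef; apply/eqP; move: nef; apply/implyP.
  by move/forall_inP/(_ e Ee)/forall_inP/(_ f Ef): orthE.
have id e : e \in E -> e != 0 /\ e * e = e.
  by move=> Ee; move/forall_inP/(_ e Ee)/andP: idE => [? /eqP].
exists E; split; rewrite ?(eqP sumE) // => e Ee; have [e0 ee] := id e Ee.
split=> // g gg eg ge; case: (eqVneq g 0) => [|g0]; first by left.
case: (eqVneq g e) => [|nge]; first by right.
pose h := e - g.
have h0 : h != 0 by rewrite subr_eq0 eq_sym.
have hh : h * h = h by rewrite mulrBr !mulrBl ee ge eg gg subrr subr0.
have gh : g * h = 0 by rewrite mulrBr ge gg subrr.
have hg : h * g = 0 by rewrite mulrBl eg gg subrr.
have he : h * e = h by rewrite mulrBl ee ge.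
have eh : e * h = h by rewrite mulrBr ee eg.
have orth_sub k f : k * e = k -> e * k = k -> f \in E :\ e ->
    k * f = 0 /\ f * k = 0.
  move=> ke ek /setD1P[nfe Ef]; split.
  - by rewrite -ke -mulrA (orth e f) ?mulr0 1?eq_sym.
  - by rewrite -ek mulrA (orth f e) ?mul0r.
have notin k : k != 0 -> k * k = k -> k * e = k -> e * k = k ->
    k \notin E :\ e.
  move=> k0 kk ke ek; apply: contra k0 => Ek.
  by have [+ _] := orth_sub k k ke ek Ek; rewrite kk => ->.
have ngh : g != h by apply: contra g0 => /eqP eq; rewrite -gg {2}eq gh.
have nhE := notin h h0 hh he eh; have ngE := notin g g0 gg ge eg.
have ngF : g \notin h |: E :\ e by rewrite in_setU1 negb_or ngh.
have: complete_orthogonal (g |: (h |: E :\ e)).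
  apply/and3P; split.
  - apply/forall_inP => k /setU1P[->|/setU1P[->|/setD1P[_ Ek]]].
    + by rewrite g0 gg eqxx.
    + by rewrite h0 hh eqxx.
    + by have [-> ->] := id k Ek; rewrite eqxx.
  - apply/forall_inP => k Hk; apply/forall_inP => f Hf; apply/implyP => nkf.
    apply/eqP; move: Hk Hf nkf.
    move=> /setU1P[->|/setU1P[->|Hk]] /setU1P[->|/setU1P[->|Hf]];
      rewrite ?eqxx ?gh ?hg // => nkf.
    + by case: (orth_sub g f).
    + by case: (orth_sub h f).
    + by case: (orth_sub g k).
    + by case: (orth_sub h k).
    + by move: Hk Hf => /setD1P[_ Ek] /setD1P[_ Ef]; apply: orth.
  - rewrite !big_setU1 //= addrA -(eqP sumE) (big_setD1 e Ee) /=.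
    by rewrite [g + h]addrC subrK.
move/maxE; rewrite !cardsU1 ngF nhE (cardsD1 e E) Ee.
by rewrite !add1n /= ltnn.
Qed.

(** * Sums of two units in corners *)

Definition corner_two_sum e x : Prop :=
  exists u v, [/\ corner_unit e u, corner_unit e v &
    e * x * e = e * (u + v) * e].

Section Gluing.
Variables (e f : R).
Hypotheses (ee : e * e = e) (ff : f * f = f) (ef : e * f = 0) (fe : f * e = 0).

Lemma corner_triangularE u v x :
  (e + f) * (e * u * e + f * v * f + e * x * f) * (e + f) =
  e * u * e + f * v * f + e * x * f.
Proof.
rewrite !(mulrDl, mulrDr) !mulrA ee ef fe ff !mul0r.
by rewrite -!mulrA ee ef fe ff !mulr0 !(addr0, add0r) addrA addrAC.
Qed.

(** The block matrix with diagonal blocks e u e, f v f and upper right block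
    e x f is the product of a unipotent and a block diagonal matrix. *)
Lemma corner_unit_triangular u v x : corner_unit e u -> corner_unit f v ->
  corner_unit (e + f) (e * u * e + f * v * f + e * x * f).
Proof.
move=> Uu Uv; have [z [fz zf zvf _]] := corner_unit_inv ff Uv.
move: Uu Uv; rewrite /corner_unit.
set S := _ + (1 - e); set T := _ + (1 - f) => US UT.
(* c is e x f divided on the right by the block f v f, so that 1 + c is the
   unipotent factor *)
pose c := e * x * z.
have ce : c * e = 0 by rewrite /c -zf -!mulrA fe !mulr0.
have cf : c * f = c by rewrite /c -mulrA zf.
have ec : e * c = c by rewrite /c !mulrA ee.
have cT : c * T = e * x * f.
  rewrite mulrDr mulrBr mulr1 cf subrr addr0 !mulrA cf.
  by rewrite /c -!mulrA [z * _]mulrA zvf.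
have cS : c * S = c.
  by rewrite mulrDr mulrBr mulr1 !mulrA ce !mul0r subr0 add0r.
have cc : c * c = 0 by rewrite -{2}ec mulrA ce mul0r.
have Uc : 1 + c \is a GRing.unit.
  by rewrite -[c]opprK unitr_1B_sqr0 // mulrNN.
suff -> : (e + f) * (e * u * e + f * v * f + e * x * f) * (e + f)
          + (1 - (e + f)) = (1 + c) * (S * T).
  by rewrite !fin_unitrM Uc US UT.
rewrite corner_triangularE [RHS]mulrDl mul1r mulrA cS cT.
have -> : S * T = e * u * e + f * v * f + (1 - (e + f)).
  rewrite mulrDl.
  have -> : e * u * e * T = e * u * e.
    rewrite mulrDr mulrBr mulr1 -!mulrA ![e * (f * _)]mulrA ef.
    by rewrite !(mul0r, mulr0) add0r subr0.
  have -> : (1 - e) * T = f * v * f + (1 - (e + f)).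
    rewrite mulrBl mul1r /T mulrDr mulrBr mulr1 ef !mulrA ef !mul0r add0r subr0.
    by rewrite opprD !addrA [LHS]addrAC.
  by rewrite addrA.
by rewrite [RHS]addrAC.
Qed.

End Gluing.

(** The block e x f goes into the first summand, which becomes upper triangular,
    and f x e into the second, which becomes lower triangular. *)
Lemma corner_two_sum_glue e f x : e * e = e -> f * f = f ->
  e * f = 0 -> f * e = 0 ->
  corner_two_sum e x -> corner_two_sum f x -> corner_two_sum (e + f) x.
Proof.
move=> ee ff ef fe [u1 [v1 [Uu1 Uv1 xe]]] [u2 [v2 [Uu2 Uv2 xf]]].
exists (e * u1 * e + f * u2 * f + e * x * f).
exists (f * v2 * f + e * v1 * e + f * x * e); split.
- exact: corner_unit_triangular.
- by rewrite addrC; apply: corner_unit_triangular.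
- have EU := corner_triangularE ee ff ef fe u1 u2 x.
  have EV := corner_triangularE ff ee fe ef v2 v1 x; rewrite [f + e]addrC in EV.
  have cornerD c a b : c * (a + b) * c = c * a * c + c * b * c.
    by rewrite mulrDr mulrDl.
  rewrite cornerD {}EU {}EV.
  have -> : (e + f) * x * (e + f) =
            e * x * e + f * x * f + e * x * f + f * x * e.
    by rewrite mulrDl mulrDr !mulrDl [LHS](AC (2*2) (1*4*3*2)).
  by rewrite {}xe {}xf !(mulrDr, mulrDl) [LHS](AC (2*2*1*1) (1*3*5*(4*2*6))).
Qed.

(** * Clearing two diagonal corners *)

(** Equivalent to the left modules R i and R j being isomorphic. *)
Definition isomorphic_idempotents i j : Prop :=
  exists a b, [/\ i * a * j = a, j * b * i = b, a * b = i & b * a = j].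

(** Since i x i is invertible, one row and one column operation make the block
    of x on i and j diagonal; the exchange of the two rows, which exists because
    i and j are isomorphic, then moves both entries off the diagonal. *)
Lemma clear_two_corners i j x :
  i * i = i -> j * j = j -> i * j = 0 -> j * i = 0 ->
  isomorphic_idempotents i j -> corner_unit i x ->
  exists w v, [/\ w \is a GRing.unit, v \is a GRing.unit,
    i * (w * x * v) * i = 0, j * (w * x * v) * j = 0 &
    forall k, k * i = 0 -> i * k = 0 -> k * j = 0 -> j * k = 0 ->
      k * (w * x * v) * k = k * x * k].
Proof.
move=> ii jj ij ji [a [b [iaj jbi ab ba]]] Ux.
have ia : i * a = a by rewrite -iaj !mulrA ii.
have aj : a * j = a by rewrite -iaj -[_ * j * j]mulrA jj.
have jb : j * b = b by rewrite -jbi !mulrA jj.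
have bi : b * i = b by rewrite -jbi -[_ * i * i]mulrA ii.
have [z [iz zi zxi ixz]] := corner_unit_inv ii Ux.
(* 1 - r clears the entry (j, i), 1 - q clears the entry (i, j), and s
   exchanges i and j along the isomorphism *)
pose r := j * x * z; pose q := z * x * j; pose s := 1 - i - j + a + b.
have ib : i * b = 0 by rewrite -jb mulrA ij mul0r.
have ja : j * a = 0 by rewrite -ia mulrA ji mul0r.
have bj : b * j = 0 by rewrite -bi -mulrA ij mulr0.
have ai : a * i = 0 by rewrite -aj -mulrA ji mulr0.
have aa : a * a = 0 by rewrite -{2}ia mulrA ai mul0r.
have bb : b * b = 0 by rewrite -{2}jb mulrA bj mul0r.
have is_ : i * s = a.
  by rewrite /s !mulrDr !mulrN mulr1 ii ij ib subrr subr0 add0r addr0.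
have js : j * s = b.
  by rewrite /s !mulrDr !mulrN mulr1 jj ji ja subr0 subrr addr0 add0r.
have ss : s * s = 1.
  rewrite {1}/s mulrDl mulrDl mulrBl mulrBl mul1r is_ js.
  rewrite /s !mulrDr !mulrN !mulr1 ai aj aa ab bi bj bb ba !subr0.
  rewrite !subrr !add0r addr0 [LHS](AC (7*1*1) (1*(2*8)*(3*9)*(4*6)*(5*7))).
  by rewrite /= !(subrr, addNr) !addr0.
have zj : z * j = 0 by rewrite -zi -mulrA ij mulr0.
have jz : j * z = 0 by rewrite -iz mulrA ji mul0r.
have rr : r * r = 0 by rewrite /r !mulrA -[_ * z * j]mulrA zj mulr0 !mul0r.
have qq : q * q = 0 by rewrite /q !mulrA -[_ * j * z]mulrA jz mulr0 !mul0r.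
have jr : j * r = r by rewrite /r !mulrA jj.
have ir : i * r = 0 by rewrite /r !mulrA ij !mul0r.
have qi : q * i = 0 by rewrite /q -mulrA ji mulr0.
have qj : q * j = q by rewrite /q -mulrA jj.
exists (s * (1 - r)), (1 - q); split.
- by rewrite fin_unitrM (fin_unitr ss) unitr_1B_sqr0.
- exact: unitr_1B_sqr0.
- have xi : (j - r) * (x * i) = 0.
    by rewrite mulrBl /r -!mulrA [z * (x * i)]mulrA zxi subrr.
  have j1r : j * (1 - r) = j - r by rewrite mulrBr mulr1 jr.
  have q1i : (1 - q) * i = i by rewrite mulrBl mul1r qi subr0.
  rewrite !mulrA is_ -[a]aj -[a * j * _]mulrA j1r.
  by rewrite -[_ * (1 - q) * i]mulrA q1i -!mulrA xi mulr0.
- have xj : i * x * (j - q) = 0.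
    by rewrite mulrBr /q !mulrA ixz subrr.
  have i1r : i * (1 - r) = i by rewrite mulrBr mulr1 ir subr0.
  have q1j : (1 - q) * j = j - q by rewrite mulrBl mul1r qj.
  rewrite !mulrA js -[b]bi -[b * i * _]mulrA i1r.
  by rewrite -[_ * (1 - q) * j]mulrA q1j -!mulrA [i * (x * _)]mulrA xj mulr0.
- move=> k ki ik kj jk.
  have ks : k * s = k.
    rewrite /s !mulrDr !mulrN mulr1 ki kj !subr0 -ia -jb !mulrA ki kj.
    by rewrite !mul0r !addr0.
  have k1r : k * (1 - r) = k by rewrite mulrBr mulr1 /r !mulrA kj !mul0r subr0.
  have q1k : (1 - q) * k = k.
    by rewrite mulrBl mul1r /q -[_ * j * k]mulrA jk mulr0 subr0.
  by rewrite !mulrA ks k1r -[_ * (1 - q) * k]mulrA q1k.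
Qed.

(** After normalizing by the inverse of i a j b i, the product in the other
    order is a nonzero idempotent of j R j, hence j by primitivity. *)
Lemma corner_iso_of_corner_unit i j a b :
  i * i = i -> i != 0 -> primitive_idempotent j ->
  corner_unit i (a * j * b) ->
  isomorphic_idempotents i j.
Proof.
move=> ii i0 [_ jj prim] U; have [z [iz zi zabi iabz]] := corner_unit_inv ii U.
pose a' := i * a * j; pose b' := j * b * z.
have ia : i * a' = a' by rewrite /a' !mulrA ii.
have aj : a' * j = a' by rewrite /a' -mulrA jj.
have jb : j * b' = b' by rewrite /b' !mulrA jj.
have bi : b' * i = b' by rewrite /b' -mulrA zi.
have ab : a' * b' = i by rewrite -[RHS]iabz /a' /b' !mulrA -[_ * j * j]mulrA jj.
exists a', b'; rewrite ia aj jb bi; split=> //.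
have [||||//] := prim (b' * a').
- by rewrite -mulrA [a' * _]mulrA ab ia.
- by rewrite mulrA jb.
- by rewrite -mulrA aj.
move=> ba0; move: i0; rewrite -ii -{1}ab -ab -mulrA [b' * (a' * b')]mulrA ba0.
by rewrite mul0r mulr0 eqxx.
Qed.

(** * The quotient F_2 *)

(** The corner of x y at i is the sum of the i x j y i, in which all terms with
    j distinct from i are nonunits; so the residue of i x i in F_2 is
    multiplicative in x. *)
Lemma residue_F2_quotient E i : primitive_decomposition E -> i \in E ->
  ~~ corner_exceptional i ->
  (forall j a b, j \in E -> j != i -> ~~ corner_unit i (a * j * b)) ->
  is_quotient R 'F_2.
Proof.
move=> [primE _ sumE] Ei bad noniso; have prim := primE i Ei.
have [i0 ii _] := prim.
have cuD := corner_unitD prim bad; have cuN := corner_unitN ii.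
have cuM x y : corner_unit i (x * y) = corner_unit i x && corner_unit i y.
  rewrite -corner_unitM // -[x in LHS]mulr1 -sumE mulr_sumr mulr_suml.
  rewrite (big_setD1 i Ei) /= cuD [X in _ (+) X](_ : _ = false) ?addbF //.
  elim/big_ind: _ => [|a b|j /setD1P[nji Ej]]; first exact/negbTE/corner_unit0.
  - by rewrite cuD => -> ->.
  - exact/negbTE/noniso.
pose f x : 'F_2 := (corner_unit i x : nat)%:R.
have fB : zmod_morphism f.
  by move=> x y; rewrite /f cuD cuN; do 2!case: corner_unit; apply/val_inj.
have fM : monoid_morphism f.
  split=> [|x y]; first by rewrite /f corner_unit1.
  by rewrite /f cuM; do 2!case: corner_unit; apply/val_inj.
pose fA := GRing.isZmodMorphism.Build R 'F_2 f fB.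
pose fR := GRing.isMonoidMorphism.Build R 'F_2 f fM.
pose F : {rmorphism R -> 'F_2} := HB.pack f fA fR.
exists F => y; case: (eqVneq y 0) => [->|y0]; first
    by exists 0; rewrite rmorph0.
exists 1; rewrite rmorph1; apply/val_inj; move: y y0.
by case=> [[|[|n]] lt_n2].
Qed.

(** * Every element is a sum of two units *)

Lemma corner_two_sum_primitive e x : primitive_idempotent e ->
  corner_exceptional e || ~~ corner_unit e x -> corner_two_sum e x.
Proof.
move=> prim; have [_ ee _] := prim.
have [Ux|nUx _] := boolP (corner_unit e x).
  rewrite orbF => /existsP[a /andP[Ua U1a]].
  exists (x * e * a), (x * e * (1 - a)); rewrite !corner_unitM // Ux Ua U1a.
  by split=> //; rewrite -mulrDr [a + _]addrC subrK mulr1 -!mulrA ee.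
have xE : 1 + (x - 1) = x by rewrite addrC subrK.
exists 1, (x - 1); rewrite corner_unit1 // xE -opprB corner_unitN //.
split=> //; have := primitive_corner_local x prim.
by rewrite (negPf nUx).
Qed.

(** The diagonal positions to which [corner_two_sum_primitive] does not
    apply. *)
Definition obstruction E x : {set R} :=
  [set i in E | ~~ corner_exceptional i & corner_unit i x].

Lemma two_sum_of_no_obstruction E x : primitive_decomposition E ->
  obstruction E x = set0 ->
  exists u v, [/\ u \is a GRing.unit, v \is a GRing.unit & x = u + v].
Proof.
move=> [primE orthE sumE] no_obs.
have twoE e : e \in E -> corner_two_sum e x.
  move=> Ee; apply: corner_two_sum_primitive; first exact: primE.
  apply/negPn; rewrite negb_or negbK; apply/negP => h.
  by have := in_set0 e; rewrite -no_obs inE Ee h.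
suff: corner_two_sum 1 x.
  case=> u [v []]; rewrite /corner_unit subrr !mul1r !mulr1 !addr0 => Uu Uv xuv.
  by exists u, v.
rewrite -sumE.
(* partial sums of the decomposition; the second clause keeps the next
   idempotent orthogonal to the partial sum *)
have gen (s : seq R) : uniq s -> {subset s <= E} ->
    let e := \sum_(k <- s) k in
    [/\ e * e = e, forall f, f \in E -> f \notin s -> e * f = 0 /\ f * e = 0
      & corner_two_sum e x].
  elim: s => [|k s IHs] /=.
    rewrite big_nil; split; first by rewrite mulr0.
      by move=> f; rewrite mul0r mulr0.
    by exists 0, 0; rewrite /corner_unit !mulr0 subr0 add0r unitr1.
  case/andP=> nks us sub.
  have Ek : k \in E by apply: sub; rewrite mem_head.
  have [|ee orth_e two_e] := IHs us.
    by move=> t st; apply: sub; rewrite in_cons st orbT.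
  have [_ kk _] := primE k Ek; have [ek ke] := orth_e k Ek nks.
  rewrite big_cons; split.
  - by rewrite mulrDl !mulrDr kk ke ek ee addr0 add0r.
  - move=> f Ef; rewrite in_cons negb_or => /andP[nfk nfs].
    have [ef fe] := orth_e f Ef nfs.
    by rewrite mulrDl mulrDr ef fe !orthE ?addr0 // eq_sym.
  - by apply: corner_two_sum_glue => //; apply: twoE.
have [||_ _] := gen (enum E); first exact: enum_uniq.
  by move=> k; rewrite mem_enum.
by rewrite big_enum.
Qed.

(** Induction on the number of obstructions, removing at least one at each step
    by multiplying x by units on both sides. *)
Lemma two_sum_of_no_F2_quotient x : ~ is_quotient R 'F_2 ->
  exists u v, [/\ u \is a GRing.unit, v \is a GRing.unit & x = u + v].
Proof.
move=> noF2; have [E decE] := primitive_decomposition_exists.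
have [primE orthE sumE] := decE.
have [n] := ubnP #|obstruction E x|; elim: n x => // n IHn x lt_n.
case: (set_0Vmem (obstruction E x)) => [/(two_sum_of_no_obstruction decE)//|].
case=> i obs_i; have := obs_i; rewrite inE => /and3P[Ei bad_i Ux].
have [i0 ii _] := primE i Ei.
have [j [Ej nji [a [b Uab]]]] : exists j, [/\ j \in E, j != i &
    exists a b, corner_unit i (a * j * b)].
  have [/existsP[j /andP[Ej /andP[nji /existsP[a /existsP[b Uab]]]]]|none] :=
    boolP [exists j, (j \in E) && ((j != i) &&
             [exists a, exists b, corner_unit i (a * j * b)])].
    by exists j; split=> //; exists a, b.
  case: noF2; apply: residue_F2_quotient decE Ei bad_i _ => j a b Ej nji.
  apply: contra none => Uab; apply/existsP; exists j; rewrite Ej nji /=.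
  by apply/existsP; exists a; apply/existsP; exists b.
have iso_ij := corner_iso_of_corner_unit ii i0 (primE j Ej) Uab.
have [j0 jj _] := primE j Ej.
have ji : j * i = 0 by apply: orthE.
have ij : i * j = 0 by apply: orthE; rewrite // eq_sym.
have [w [v [Uw Uv xi xj xk]]] :=
  clear_two_corners ii jj ij ji iso_ij Ux.
have nU k : k * k = k -> k != 0 -> k * (w * x * v) * k = 0 ->
    corner_unit k (w * x * v) = false.
  move=> kk k0 k_eq; apply/negbTE.
  rewrite (@corner_unit_eq _ _ 0) ?corner_unit0 //.
  by rewrite k_eq mulr0 mul0r.
have sub : obstruction E (w * x * v) \subset obstruction E x :\ i.
  apply/subsetP => k; rewrite !inE => /and3P[Ek bad_k Uk].
  have nki : k != i by apply: contraTneq Uk => ->; rewrite nU.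
  have nkj : k != j by apply: contraTneq Uk => ->; rewrite nU.
  rewrite nki Ek bad_k -(@corner_unit_eq k (w * x * v)) //.
  by apply: xk; apply: orthE => //; rewrite eq_sym.
have [|u1 [u2 [Uu1 Uu2 eq_wxv]]] := IHn (w * x * v).
  apply: leq_ltn_trans (subset_leq_card sub) _.
  by move: lt_n; rewrite (cardsD1 i) obs_i.
exists (w^-1 * u1 * v^-1), (w^-1 * u2 * v^-1).
rewrite !fin_unitrM !unitrV Uw Uv Uu1 Uu2; split=> //.
by rewrite -mulrDl -mulrDr -eq_wxv !mulrA mulVr // mul1r mulrK.
Qed.

End FiniteRing.

(** * Equivalence of the four conditions *)

Theorem theorem2p1 (R : finUnitRingType) :
  [<-> ~ is_quotient R 'F_2;
       n_sum_property 2 R;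
       exists u : R, exceptional_unit u;
       ~ bipartite (@unitary_cayley_graph R)].
Proof.
tfae=> [noF2 x|two|[u /andP[Uu U1u]] [A [B [covAB disjAB adj]]]|nbip [f fsurj]].
- have [u [v [Uu Uv ->]]] := two_sum_of_no_F2_quotient x noF2.
  exists (fun i : 'I_2 => if i == ord0 then u else v); split.
    by move=> i; case: ifP.
  by rewrite !big_ord_recl big_ord0 addr0.
- have [u [Uu one]] := two 1; exists (u ord0); rewrite /exceptional_unit Uu one.
  by rewrite !big_ord_recl big_ord0 addr0 addrC addKr Uu.
- have same y : (y \in A) = ~~ (y \in B).
    have := in_setT y; rewrite -covAB in_setU.
    case yA: (y \in A); first by rewrite (disjointFr disjAB yA).
    by move=> /= ->.
  have h10 := adj 1 0; have hu0 := adj u 0; have h1u := adj 1 u.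
  move: h10 hu0 h1u; rewrite /unitary_cayley_graph !subr0 unitr1 Uu U1u !same.
  by case: (1 \in B) (0 \in B) (u \in B) => [] [] [] // h1 h2 h3;
     have := (h1 isT, h2 isT, h3 isT) => -[[]].
- apply: nbip; exists [set x | f x == 0], [set x | f x != 0]; split.
  + by apply/setP => x; rewrite !inE orbN.
  + by apply/pred0P => x; rewrite /= !inE andbN.
  + move=> x y /(rmorph_unit f); rewrite rmorphB !inE.
    case: (f x) (f y) => [[|[|n]] ?] [[|[|m]] ?] //.
Qed.
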